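(* Let $P=\langle\mathbf{x},Q,q_{init},\Delta\rangle$ be an integer program. Let $[\![P]\!]^*_\sharp,[\![P]\!]^{TInv}_\sharp:Q\times Q\to2^{\mathbb{Z}^{\mathbf{x}}\times\mathbb{Z}^{\mathbf{x}}}$ be mappings with $[\![P]\!]^*_\sharp(q,q')\supseteq[\![P]\!]^*(q,q')$ and $[\![P]\!]^{TInv}_\sharp(q,q')\supseteq[\![P]\!]^{TInv}(q,q')$ for all $q,q'\in Q$. For each $q\in Q$ let $p_q\ge1$ and let $R_{q,1},\dots,R_{q,p_q}\subseteq\mathbb{Z}^{\mathbf{x}}\times\mathbb{Z}^{\mathbf{x}}$ be relations with $[\![P]\!]^{TInv}_\sharp(q,q)=\bigcup_{k=1}^{p_q}R_{q,k}$. Let $$\mathcal{N}=\bigcup_{q\in Q}\big([\![P]\!]^*_\sharp(q_{init},q)\big)^{-1}\Big(\bigcup_{k=1}^{p_q}\mathrm{wnt}(R_{q,k})\Big).$$ Then $[\![P]\!]^{wnt}(q_{init})\subseteq\mathcal{N}$. Moreover, if $[\![P]\!]^{TInv}_\sharp=[\![P]\!]^{TInv}$ and $[\![P]\!]^*_\sharp=[\![P]\!]^*$, then $\mathcal{N}=[\![P]\!]^{wnt}(q_{init})$.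
   Context: An integer program is a tuple $P=\langle\mathbf{x},Q,q_{init},\Delta\rangle$ where $\mathbf{x}$ is a finite set of integer variables, $Q$ a finite set of control states, $q_{init}\in Q$, and $\Delta$ a finite set of transition rules $q\xrightarrow{R(\mathbf{x},\mathbf{x}')}q'$ with $R$ a quantifier-free Presburger formula over $\mathbf{x}$ and primed copies $\mathbf{x}'$. A configuration is a pair $\langle q,\nu\rangle$, $q\in Q$, $\nu\in\mathbb{Z}^{\mathbf{x}}$ (a valuation). $\langle q',\nu'\rangle$ is an immediate successor of $\langle q,\nu\rangle$ if some $q\xrightarrow{R}q'\in\Delta$ has $(\nu,\nu')\models R$. A run of length $k\ge0$ is a sequence of $k+1$ configurations, each an immediate successor of the previous; infinite runs are defined likewise. For $q,q'\in Q$: $[\![P]\!]^+(q,q')$ (resp. $[\![P]\!]^*(q,q')$) is the set of pairs $\langle\nu,\nu'\rangle$ such that there is a run of length $k\ge1$ (resp. $k\ge0$) from $\langle q,\nu\rangle$ to $\langle q',\nu'\rangle$; $[\![P]\!]^{wnt}(q)$ is the set of $\nu$ such that some infinite run starts in $\langle q,\nu\rangle$; and $[\![P]\!]^{TInv}(q,q')=\{\langle\nu,\nu'\rangle\in[\![P]\!]^+(q,q')\mid\nu\in([\![P]\!]^*(q_{init},q))(\mathbb{Z}^{\mathbf{x}})\}$. For a relation $\rho$ and a set $S$: $\rho(S)=\{\nu'\mid\exists\nu\in S.\ (\nu,\nu')\in\rho\}$ and $\rho^{-1}(S)=\{\nu\mid\exists\nu'\in S.\ (\nu,\nu')\in\rho\}$.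 For a relation $R$ on $\mathbb{Z}^{\mathbf{x}}$, $\mathrm{wnt}(R)$ is the set of $\nu$ for which there is an infinite sequence $\nu=\nu_0,\nu_1,\dots$ with $(\nu_i,\nu_{i+1})\in R$ for all $i\ge0$. *)

(* Defs.v *)
From mathcomp Require Import all_boot all_order all_algebra.
From mathcomp Require Import mathcomp_extra boolp classical_sets.

Set Implicit Arguments.
Unset Strict Implicit.
Unset Printing Implicit Defensive.

Import Order.TTheory GRing.Theory Num.Theory.

Local Open Scope ring_scope.
Local Open Scope classical_set_scope.

Inductive pterm (V : Type) : Type :=
| PVar of V
| PConst of int
| PAdd of pterm V & pterm V
| PScale of int & pterm V.

(** Congruence atoms are included: without them the language would not have the
    expressive power of full (quantified) Presburger arithmetic.  The remaining usual atoms
    and connectives (equality, strict order, disjunction) are definable. *)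
Inductive pformula (V : Type) : Type :=
| PFalse
| PLe of pterm V & pterm V
| PDvd of nat & pterm V
| PNot of pformula V
| PAnd of pformula V & pformula V.

Fixpoint peval (V : Type) (e : V -> int) (t : pterm V) : int :=
  match t with
  | PVar x => e x
  | PConst c => c
  | PAdd t1 t2 => peval e t1 + peval e t2
  | PScale c t1 => c * peval e t1
  end.

Fixpoint psat (V : Type) (e : V -> int) (f : pformula V) : bool :=
  match f with
  | PFalse => false
  | PLe t1 t2 => peval e t1 <= peval e t2
  | PDvd m t => (m%:Z %| peval e t)%Z
  | PNot f1 => ~~ psat e f1
  | PAnd f1 f2 => psat e f1 && psat e f2
  end.

(** In a guard, [inl x] is the variable [x] and [inr x] its primed copy. *)
Record rule (X Q : Type) : Type := Rule {
  source : Q;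
  guard : pformula (X + X);
  target : Q
}.

Record intprog : Type := IntProg {
  pvar : finType;
  pstate : finType;
  qinit : pstate;
  rules : seq (rule pvar pstate)
}.

Definition valuation (P : intprog) : Type := {ffun pvar P -> int}.

Definition config (P : intprog) : Type := (pstate P * valuation P)%type.

Definition env2 (P : intprog) (nu nu' : valuation P) (v : pvar P + pvar P) : int :=
  match v with inl x => nu x | inr x => nu' x end.

Definition succ (P : intprog) : rel (config P) := fun c c' =>
  has (fun r => [&& source r == c.1, target r == c'.1
                  & psat (env2 c.2 c'.2) (guard r)]) (rules P).

(** [is_run c s]: the configurations [c :: s] form a run, of length [size s]. *)
Definition is_run (P : intprog) (c : config P) (s : seq (config P)) : Prop :=
  path (@succ P) c s.

Definition is_infinite_run (P : intprog) (c : nat -> config P) : Prop :=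
  forall i, succ (c i) (c i.+1).

Definition rel_image (T : Type) (rho : set (T * T)) (S : set T) : set T :=
  [set y | exists2 x, S x & rho (x, y)].

Definition rel_preimage (T : Type) (rho : set (T * T)) (S : set T) : set T :=
  [set x | exists2 y, S y & rho (x, y)].

Definition wnt (T : Type) (R : set (T * T)) : set T :=
  [set x | exists u : nat -> T, u 0%N = x /\ forall i, R (u i, u i.+1)].

(** A map [Q * Q -> 2^(Z^x * Z^x)], in curried form. *)
Definition summary (P : intprog) : Type :=
  pstate P -> pstate P -> set (valuation P * valuation P).

Definition prog_plus (P : intprog) : summary P := fun q q' =>
  [set nn | exists s : seq (config P),
     [/\ (1 <= size s)%N, is_run (q, nn.1) s & last (q, nn.1) s = (q', nn.2)]].

Definition prog_star (P : intprog) : summary P := fun q q' =>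
  [set nn | exists s : seq (config P),
     is_run (q, nn.1) s /\ last (q, nn.1) s = (q', nn.2)].

Definition prog_wnt (P : intprog) (q : pstate P) : set (valuation P) :=
  [set nu | exists c : nat -> config P, c 0%N = (q, nu) /\ is_infinite_run c].

Definition prog_tinv (P : intprog) : summary P := fun q q' =>
  [set nn | prog_plus q q' nn /\
            rel_image (prog_star (qinit P) q) [set: valuation P] nn.1].

Definition nonterm_bound (P : intprog) (star_sharp : summary P)
    (p : pstate P -> nat)
    (R : forall q : pstate P, 'I_(p q) -> set (valuation P * valuation P)) :
    set (valuation P) :=
  \bigcup_(q : pstate P)
     rel_preimage (star_sharp (qinit P) q) (\bigcup_(k : 'I_(p q)) wnt (R q k)).

(* Main.v *)
(** Along an infinite run, a nonprincipal ultrafilter on the positions selects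
    a control state [q], and then, Ramsey-style, an index [k] such that for
    ultrafilter-many positions [i] on [q], ultrafilter-many later positions [j]
    are related to [i] by [R q k]; picking such positions one after the other
    gives an infinite [R q k]-chain.  Conversely, from any configuration that
    reaches some member of an infinite chain of nonempty runs, one can step to
    another such configuration, so an infinite run exists by dependent choice. *)
Require Import Defs.
From mathcomp Require Import all_boot all_order all_algebra.
From mathcomp Require Import mathcomp_extra boolp classical_sets.
From mathcomp Require Import filter topology.

Set Implicit Arguments.
Unset Strict Implicit.
Unset Printing Implicit Defensive.

Local Open Scope classical_set_scope.

(** Plain dependent choice on the subtype of [A], so that a step may rely on an invariant. *)
Lemma dependent_choice_in (T : Type) (A : set T) (r : T -> T -> Prop) :
    (forall x, A x -> exists2 y, A y & r x y) ->
  forall x, A x -> exists u : nat -> T,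
    [/\ u 0%N = x, forall i, A (u i) & forall i, r (u i) (u i.+1)].
Proof.
move=> step x Ax.
have stepS (y : {y | A y}) : {z : {z | A z} | r (sval y) (sval z)}.
  by apply: cid; have [z Az ryz] := step _ (svalP y); exists (exist _ z Az).
have [u [u0 ru]] := dependent_choice stepS (exist _ x Ax).
by exists (sval \o u); split=> [|i|i] /=; [rewrite u0 | apply: svalP | apply: ru].
Qed.

(** Otherwise [F] contains every complement, hence their finite intersection, which is disjoint from
    the union. *)
Lemma ultra_bigcup (T : Type) (F : set_system T) (I : finType) (A : I -> set T) :
  UltraFilter F -> F (\bigcup_i A i) -> exists i, F (A i).
Proof.
move=> FU FA; apply: contrapT => noA.
have : F (fun x => forall i, (~` A i) x).
  apply: filter_forall => i.
  by have [FAi|//] := in_ultra_setVsetC (A i) FU; case: noA; exists i.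
move=> /(filterI FA)/filter_ex[x [[i _ Aix] /(_ i)]]; exact.
Qed.

Lemma infinite_run_path (P : intprog) (c : nat -> config P) (i n : nat) :
  is_infinite_run c -> exists s, [/\ size s = n, is_run (c i) s
                                   & last (c i) s = c (i + n)%N].
Proof.
move=> crun; elim: n i => [|n IHn] i; first by exists [::]; rewrite addn0.
have [s [sz rs ls]] := IHn i.+1; exists (c i.+1 :: s).
by rewrite /is_run /= sz ls addSnnS; split=> //; rewrite crun.
Qed.

Lemma infinite_run_star (P : intprog) (c : nat -> config P) (i j : nat) :
    is_infinite_run c -> (i <= j)%N ->
  prog_star (c i).1 (c j).1 ((c i).2, (c j).2).
Proof.
move=> crun le_ij; have [s [_ rs ls]] := infinite_run_path i (j - i) crun.
by exists s; rewrite /= -!surjective_pairing ls subnKC.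
Qed.

Lemma infinite_run_plus (P : intprog) (c : nat -> config P) (i j : nat) :
    is_infinite_run c -> (i < j)%N ->
  prog_plus (c i).1 (c j).1 ((c i).2, (c j).2).
Proof.
move=> crun lt_ij; have [s [sz rs ls]] := infinite_run_path i (j - i) crun.
by exists s; rewrite /= -!surjective_pairing ls sz subn_gt0 subnKC // ltnW.
Qed.

Lemma infinite_run_tinv (P : intprog) (c : nat -> config P) (i j : nat) :
    is_infinite_run c -> (c 0%N).1 = qinit P -> (i < j)%N ->
  prog_tinv (c i).1 (c j).1 ((c i).2, (c j).2).
Proof.
move=> crun c0 lt_ij; split; first exact: infinite_run_plus.
by exists (c 0%N).2 => //; rewrite -c0; apply: infinite_run_star.
Qed.

Lemma prog_wnt_chain (P : intprog) (q0 q : pstate P) (nu : valuation P)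
    (u : nat -> valuation P) :
    prog_star q0 q (nu, u 0%N) ->
    (forall i, prog_plus q q (u i, u i.+1)) ->
  prog_wnt q0 nu.
Proof.
move=> [s0 [/= rs0 ls0]] chain.
pose A (d : config P) := exists i s, is_run d s /\ last d s = (q, u i).
have step d : A d -> exists2 d', A d' & succ d d'.
  move=> [i [[|d' s] [/= rs ls]]]; last first.
    by case/andP: rs => dd' rs; exists d' => //; exists i, s.
  (* Here the run is empty, so [d] is itself the chain member [(q, u i)]; the nonempty run to
     [u i.+1] supplies a first step. *)
  have [[|d' s] [//= _ /andP[dd' rs'] ls']] := chain i.
  by exists d'; [exists i.+1, s | rewrite ls].
have [|c [c0 _ crun]] := @dependent_choice_in _ A _ step (q0, nu).
  by exists 0%N, s0.
by exists c.
Qed.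

Lemma ramsey_wnt (P : intprog)
    (p : pstate P -> nat)
    (R : forall q : pstate P, 'I_(p q) -> set (valuation P * valuation P))
    (c : nat -> config P) :
    (forall i j, (i < j)%N -> (c i).1 = (c j).1 ->
       (\bigcup_k R (c i).1 k) ((c i).2, (c j).2)) ->
  exists i k, wnt (R (c i).1 k) (c i).2.
Proof.
move=> cR.
have [U [UU ooU]] := @ultraFilterLemma _ \oo _.
have [q Uq] : exists q, U [set i | (c i).1 = q].
  by apply: ultra_bigcup; apply: filterS filterT => i _; exists (c i).1.
have [k Uk] : exists k, U [set i | U [set j | R q k ((c i).2, (c j).2)]].
  apply: ultra_bigcup; apply: (filterS _ Uq) => i ciq.
  pose A k := [set j | R q k ((c i).2, (c j).2)].
  have [|k Uk] := @ultra_bigcup _ U _ A UU.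
    (* [U] refines [\oo], so it contains the positions beyond [i]; this gives the [i < j] that [cR]
       asks for. *)
    apply: (filterS _ (filterI Uq (ooU _ (nbhs_infty_gt i)))) => j [cjq /cR].
    rewrite ciq cjq; exact.
  by exists k.
have [i [Bi ciq]] := filter_ex (filterI Uk Uq).
(* The invariant keeps the successors of [x] in [U], so they meet the [U]-large set of good
   positions. *)
have step x : U [set j | R q k ((c x).2, (c j).2)] ->
    exists2 y, U [set j | R q k ((c y).2, (c j).2)] & R q k ((c x).2, (c y).2).
  by move=> /(filterI Uk)/filter_ex[y [By Rxy]]; exists y.
have [u [u0 _ Ru]] := dependent_choice_in step Bi.
by exists i; rewrite ciq; exists k, (fun n => (c (u n)).2); rewrite u0.
Qed.

Theorem theorem6p2 (P : intprog) (star_sharp tinv_sharp : summary P)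
    (Hstar : forall q q' : pstate P, prog_star q q' `<=` star_sharp q q')
    (Htinv : forall q q' : pstate P, prog_tinv q q' `<=` tinv_sharp q q')
    (p : pstate P -> nat) (Hp : forall q : pstate P, (1 <= p q)%N)
    (R : forall q : pstate P, 'I_(p q) -> set (valuation P * valuation P))
    (HR : forall q : pstate P, tinv_sharp q q = \bigcup_(k : 'I_(p q)) R q k) :
  prog_wnt (qinit P) `<=` nonterm_bound star_sharp R /\
  (tinv_sharp = @prog_tinv P -> star_sharp = @prog_star P ->
     nonterm_bound star_sharp R = prog_wnt (qinit P)).
Proof.
have wnt_sub : prog_wnt (qinit P) `<=` nonterm_bound star_sharp R.
  move=> nu [c [c0 crun]].
  have [i j lt_ij cij|i [k wk]] := @ramsey_wnt P p R c.
    (* Only the target state becomes that of [c j], to match the run from [c i] to [c j]. *)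
    rewrite -HR; apply: Htinv; rewrite [in X in prog_tinv _ X]cij.
    by apply: infinite_run_tinv; rewrite ?c0.
  exists (c i).1 => //; exists (c i).2; first by exists k.
  by apply: Hstar; have := infinite_run_star crun (leq0n i); rewrite c0.
split=> // tinvE starE; apply/seteqP; split=> // nu [q _ [nu' [k _ [u [u0 Ru]]]]].
rewrite starE -u0 => /prog_wnt_chain; apply=> i.
(* By exactness, each link of the chain is a pair of the transition invariant, hence a nonempty run
   from [q] to [q]. *)
have : (\bigcup_k R q k) (u i, u i.+1) by exists k.
by rewrite -HR tinvE => -[].
Qed.
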